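(* Let $K\in\mathbb N$, $p_1,\dots,p_K>0$ with $\sum_{k=1}^K p_k=1$, and $\sigma_1^2,\dots,\sigma_K^2>0$. Let $h\in\mathbb C$ be distributed as $h\sim\sum_{k=1}^K p_k\mathcal N_{\mathbb C}(0,\sigma_k^2)$, let $n\sim\mathcal N_{\mathbb C}(0,\eta^2)$ with $\eta^2>0$ be independent of $h$, and let $r=Q(h+n)$ where $Q(x)=\frac1{\sqrt2}(\operatorname{sign}(\operatorname{Re}x)+\mathrm j\operatorname{sign}(\operatorname{Im}x))$. Then the conditional mean estimator is $$\mathbb E[h\mid r]=\sqrt{\tfrac{2}{\pi}}\sum_{k=1}^K p_k\frac{\sigma_k^2}{\sqrt{\sigma_k^2+\eta^2}}\,r.$$
   Context: $\mathcal N_{\mathbb C}(0,\sigma^2)$ denotes the circularly symmetric complex Gaussian distribution with variance $\sigma^2$. *)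

(* Defs.v *)
From HB Require Import structures.
From mathcomp Require Import all_boot all_order all_algebra.
From mathcomp Require Import all_classical all_reals all_analysis.
Set Implicit Arguments. Unset Strict Implicit. Unset Printing Implicit Defensive.
Import Order.TTheory GRing.Theory Num.Theory.
Import numFieldNormedType.Exports.
Local Open Scope classical_set_scope.
Local Open Scope ring_scope.

(* Density on R^2 (= C identified with (Re, Im)) of the circularly symmetric
   complex Gaussian N_C(0, s2): (1/(pi s2)) exp(-(x^2+y^2)/s2). *)
Definition cgauss_pdf (R : realType) (s2 : R) (z : R * R) : R :=
  (pi * s2)^-1 * expR (- (z.1 ^+ 2 + z.2 ^+ 2) / s2).

Definition cgauss_mix_pdf (R : realType) (K : nat) (p s2 : 'I_K -> R)
  (z : R * R) : R :=
  \sum_(k < K) p k * cgauss_pdf (s2 k) z.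

Definition leb2 (R : realType) :=
  ((@lebesgue_measure R) \x (@lebesgue_measure R))%E.
Arguments leb2 R : clear implicits.

Definition has_density (d : measure_display) (T : measurableType d)
  (R : realType) (P : probability T R) (X : T -> R * R) (f : R * R -> R) :=
  measurable_fun setT X /\
  forall A : set (R * R), measurable A ->
    P (X @^-1` A) = (\int[leb2 R]_(z in A) (f z)%:E)%E.

Definition indep2 (d : measure_display) (T : measurableType d)
  (R : realType) (P : probability T R) (X Y : T -> R * R) :=
  forall A B : set (R * R), measurable A -> measurable B ->
    P (X @^-1` A `&` Y @^-1` B) = (P (X @^-1` A) * P (Y @^-1` B))%E.

Definition cond_mean (d : measure_display) (T : measurableType d)
  (R : realType) (P : probability T R) (X : T -> R) (E : set T) : R :=
  fine (\int[P]_(t in E) (X t)%:E)%E / fine (P E).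

Definition Qre (R : realType) (x : R * R) : R := Num.sg x.1 / Num.sqrt 2.
Definition Qim (R : realType) (x : R * R) : R := Num.sg x.2 / Num.sqrt 2.

(* Main.v *)
(* Given the component k of the mixture, the real and imaginary parts of h and n
   are four independent real Gaussians, so E[u(Re h) v(Im h); r = q] is the
   p_k-weighted sum of products of the one-dimensional expectations
   E[u(x); q (x + y) > 0] with x ~ N(0, s/2), y ~ N(0, e/2).  For u = 1 symmetry
   gives 1/2.  For u the positive part of the identity, Tonelli and
   \int_a^oo x g_s(x) dx = (s/2) g_s(a) reduce the expectation to
   (s/2) \int g_s(max(-y, 0)) g_e(y) dy = (s/4) (1/sqrt(pi (s + e)) + g_s(0)),
   and the g_s(0) terms cancel between the positive and negative parts. *)
Require Import Defs.
From HB Require Import structures.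
From mathcomp Require Import all_boot all_order all_algebra.
From mathcomp Require Import all_classical all_reals all_analysis.
From mathcomp Require Import measurable_realfun ring lra.
Import Order.TTheory GRing.Theory Num.Theory.
Import numFieldNormedType.Exports.
Local Open Scope classical_set_scope.
Local Open Scope ring_scope.

Import HBNNSimple.

(** * Integration against densities and against the joint law of independent variables *)

(** Monotone convergence on both sides reduces [F] to nonnegative simple functions, and linearity
    then reduces these to indicators, for which the claim is the assumed formula for [nu]. *)
Lemma ge0_integral_density (d : measure_display) (X : measurableType d)
    (R : realType) (mu nu : {measure set X -> \bar R}) (f : X -> R) (F : X -> \bar R) :
  measurable_fun setT f -> (forall x, 0 <= f x) ->
  (forall A, measurable A -> nu A = (\int[mu]_(x in A) (f x)%:E)%E) ->
  measurable_fun setT F -> (forall x, (0 <= F x)%E) ->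
  (\int[nu]_x F x = \int[mu]_x (F x * (f x)%:E))%E.
Proof.
move=> mf' f0 nuE mF F0; have mf : measurable_fun setT (EFin \o f) by exact/measurable_EFinP.
have ef0 x : (0 <= (f x)%:E)%E by rewrite lee_fin.
pose h := nnsfun_approx measurableT mF.
have cvgh x : ((h n x)%:E @[n --> \oo] --> F x)%E by exact: cvg_nnsfun_approx.
have mh n : measurable_fun setT (EFin \o h n).
  by apply/measurable_EFinP.
have ndh x : nondecreasing_seq (fun n => (h n x)%:E).
  by move=> m n mn; rewrite lee_fin; exact/lefP/nd_nnsfun_approx.
have h0 n x : (0 <= (h n x)%:E)%E by rewrite lee_fin.
transitivity (limn (fun n => \int[nu]_x (h n x)%:E))%E.
  rewrite -monotone_convergence//.
  by apply: eq_integral => x _; apply/esym/cvg_lim.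
transitivity (limn (fun n => \int[mu]_x ((h n x)%:E * (f x)%:E)))%E; last first.
  rewrite -monotone_convergence//.
  - apply: eq_integral => x _; apply/cvg_lim => //.
    by apply: cvgeZr => //; exact: cvgh.
  - by move=> n; exact: (emeasurable_funM (mh n) mf).
  - by move=> n x _; rewrite mule_ge0.
  - by move=> x _ m n mn; rewrite lee_wpmul2r//; exact: ndh.
congr (limn _); apply/funext => n.
transitivity (\sum_(k \in range (h n))
    \int[nu]_x (k * \1_(h n @^-1` [set k]) x)%:E)%E.
  under eq_integral do rewrite fimfunE -fsumEFin//.
  rewrite ge0_integral_fsum//.
  - by move=> y; exact/measurable_EFinP/measurable_funM.
  - by move=> y x _; rewrite nnfun_muleindic_ge0.
transitivity (\sum_(k \in range (h n))
    \int[mu]_x ((k * \1_(h n @^-1` [set k]) x)%:E * (f x)%:E))%E; last first.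
  rewrite -ge0_integral_fsum//.
  - apply: eq_integral => x _; rewrite -ge0_mule_fsuml//.
      by rewrite fsumEFin// -fimfunE.
    by move=> y; rewrite nnfun_muleindic_ge0.
  - move=> y; apply: emeasurable_funM => //.
    exact/measurable_EFinP/measurable_funM.
  - by move=> y x _; apply: mule_ge0 => //; exact: nnfun_muleindic_ge0.
apply: eq_fsbigr => r /[!inE] -[x _ hr].
have r0 : 0 <= r by rewrite -hr.
have mr : measurable (h n @^-1` [set r]) by [].
under eq_integral do rewrite EFinM.
rewrite ge0_integralZl//; last exact/measurable_EFinP.
under [RHS]eq_integral do rewrite EFinM -muleA.
rewrite ge0_integralZl//; last 2 first.
- by apply: emeasurable_funM => //; exact/measurable_EFinP.
- by move=> y _; apply: mule_ge0 => //; rewrite lee_fin.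
rewrite integral_indic// setIT nuE// integral_mkcond.
congr (_ * _)%E; apply: eq_integral => y _.
by rewrite epatch_indic muleC.
Qed.

(** By independence the law of [(X, Y)] agrees with the product of the marginal laws on rectangles,
    hence everywhere. Tonelli then gives an iterated integral, in which each marginal law is
    replaced by its density. *)
Lemma pair_pushforwardE (d1 d2 : measure_display) (T : measurableType d1)
    (S : measurableType d2) (R : realType) (P : probability T R)
    (mu : {measure set S -> \bar R}) (X Y : T -> S)
    (f g : S -> R) (F : S * S -> \bar R) :
  measurable_fun setT X -> measurable_fun setT Y ->
  measurable_fun setT f -> measurable_fun setT g ->
  (forall x, 0 <= f x) -> (forall x, 0 <= g x) ->
  (forall A, measurable A -> P (X @^-1` A) = (\int[mu]_(x in A) (f x)%:E)%E) ->
  (forall A, measurable A -> P (Y @^-1` A) = (\int[mu]_(x in A) (g x)%:E)%E) ->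
  (forall A B, measurable A -> measurable B ->
    P (X @^-1` A `&` Y @^-1` B) = (P (X @^-1` A) * P (Y @^-1` B))%E) ->
  measurable_fun setT F -> (forall x, (0 <= F x)%E) ->
  (\int[P]_t F (X t, Y t) =
   \int[mu]_x (\int[mu]_y (F (x, y) * (g y)%:E) * (f x)%:E))%E.
Proof.
move=> mX mY mf mg f0 g0 XE YE XY mF F0.
pose X' : {mfun T >-> S} := HB.pack X (isMeasurableFun.Build _ _ _ _ _ mX).
pose Y' : {mfun T >-> S} := HB.pack Y (isMeasurableFun.Build _ _ _ _ _ mY).
have mXY : measurable_fun setT (fun t => (X t, Y t)).
  exact: measurable_fun_pair.
pose XY' : {mfun T >-> (S * S)%type} :=
  HB.pack (fun t => (X t, Y t)) (isMeasurableFun.Build _ _ _ _ _ mXY).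
transitivity (\int[distribution P XY']_z F z)%E.
  by rewrite ge0_integral_pushforward.
(* Uniqueness of the product measure; its condition on rectangles is [XY]. *)
rewrite (eq_measure_integral (distribution P X' \x distribution P Y')%E); last first.
  move=> A mA _; apply/esym; exact: product_measure_unique.
rewrite fubini_tonelli1//.
rewrite (ge0_integral_density _ _ _ mu (distribution P X') _ _ mf f0)//; last 2 first.
- exact: measurable_fun_fubini_tonelli_F.
- by move=> x; exact: integral_ge0.
apply: eq_integral => x _; congr (_ * _)%E; rewrite /fubini_F.
rewrite (ge0_integral_density _ _ _ mu (distribution P Y') _ _ mg g0)//.
exact: measurableT_comp.
Qed.

(** Separates the real from the imaginary coordinate in the planar integrals below. *)
Lemma ge0_integral_tensor (d1 d2 : measure_display) (S1 : measurableType d1)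
    (S2 : measurableType d2) (R : realType)
    (mu1 : {sigma_finite_measure set S1 -> \bar R})
    (mu2 : {sigma_finite_measure set S2 -> \bar R})
    (f : S1 -> \bar R) (g : S2 -> \bar R) :
  measurable_fun setT f -> measurable_fun setT g ->
  (forall x, (0 <= f x)%E) -> (forall x, (0 <= g x)%E) ->
  (\int[mu1 \x mu2]_z (f z.1 * g z.2) = \int[mu1]_x f x * \int[mu2]_x g x)%E.
Proof.
move=> mf mg f0 g0; rewrite fubini_tonelli1//=; last 2 first.
- by apply: emeasurable_funM; exact: measurableT_comp.
- by move=> x; rewrite mule_ge0.
rewrite /fubini_F; under eq_integral do rewrite /= ge0_integralZl//.
by rewrite ge0_integralZr// integral_ge0.
Qed.

(** * The one-dimensional Gaussian density and its integrals *)

(* The marginal of cgauss_pdf s, i.e. the density of N(0, s / 2): the complex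
   variance s is shared equally between the real and imaginary parts. *)
Definition gauss1 (R : realType) (s x : R) : R :=
  (Num.sqrt (pi * s))^-1 * expR (- x ^+ 2 / s).

Lemma gauss1_ge0 (R : realType) (s x : R) : 0 <= gauss1 R s x.
Proof. by rewrite mulr_ge0 ?invr_ge0 ?sqrtr_ge0 ?expR_ge0. Qed.

Lemma gauss1N (R : realType) (s x : R) : gauss1 R s (- x) = gauss1 R s x.
Proof. by rewrite /gauss1 sqrrN. Qed.

(** [normal_pdf] takes a standard deviation, hence the square root of the variance [s / 2].
    Continuity and total mass [1] are inherited through this identity. *)
Lemma gauss1E (R : realType) (s : R) : 0 < s ->
  gauss1 R s = normal_pdf 0 (Num.sqrt (s / 2)).
Proof.
move=> s0; have r0 : Num.sqrt (s / 2) != 0.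
  by rewrite gt_eqF// sqrtr_gt0 divr_gt0.
rewrite normal_pdfE//; apply/funext => x.
rewrite /gauss1 /normal_peak /normal_fun subr0 sqr_sqrtr ?divr_ge0 ?ltW//.
have -> : s / 2 *+ 2 = s by rewrite -mulr_natr divfK.
by rewrite (mulrAC s) -(mulr_natr _ 2) divfK// (mulrC s).
Qed.

Lemma measurable_gauss1 (R : realType) (s : R) :
  measurable_fun setT (gauss1 R s).
Proof.
apply: measurable_funM => //; apply: measurableT_comp => //.
by apply: measurable_funM => //; apply: measurableT_comp => //; exact: measurable_funX.
Qed.

Lemma continuous_gauss1 (R : realType) (s : R) : 0 < s ->
  continuous (gauss1 R s).
Proof.
move=> s0; rewrite gauss1E//; apply: continuous_normal_pdf.
by rewrite gt_eqF// sqrtr_gt0 divr_gt0.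
Qed.

Lemma integral_gauss1 (R : realType) (s : R) : 0 < s ->
  (\int[lebesgue_measure]_x (gauss1 R s x)%:E = 1)%E.
Proof. by move=> s0; rewrite gauss1E// integral_normal_pdf. Qed.

Lemma cgauss_pdfE (R : realType) (s : R) (z : R * R) : 0 < s ->
  cgauss_pdf s z = gauss1 R s z.1 * gauss1 R s z.2.
Proof.
move=> s0; rewrite /cgauss_pdf /gauss1 mulrACA -expRD; congr (_ * expR _).
  by rewrite -invfM -expr2 sqr_sqrtr// mulr_ge0 ?pi_ge0 ?ltW.
by rewrite -mulrDl opprD.
Qed.

(** The rates in the exponents add up, [1 / s + 1 / e = (s + e) / (s * e)], so the product is again
    Gaussian up to a constant. That constant is the source of [sqrt (s2 k + eta2)] in the final
    formula. *)
Lemma gauss1M (R : realType) (s e x : R) : 0 < s -> 0 < e ->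
  gauss1 R s x * gauss1 R e x =
  (Num.sqrt (pi * (s + e)))^-1 * gauss1 R (s * e / (s + e)) x.
Proof.
move=> s0 e0; have se0 : 0 < s + e by rewrite addr_gt0.
have [sN eN seN] : [/\ s != 0, e != 0 & s + e != 0] by rewrite !gt_eqF.
rewrite /gauss1 mulrACA -expRD mulrA; congr (_ * expR _); last by field; rewrite sN eN seN.
have p0 := pi_ge0 R.
rewrite -!invfM -!sqrtrM ?mulr_ge0 ?(ltW s0) ?(ltW se0)//.
by congr (Num.sqrt _)^-1; field.
Qed.

Lemma cvg_gauss1_y (R : realType) (s : R) : 0 < s ->
  gauss1 R s x @[x --> +oo] --> 0.
Proof.
move=> s0; rewrite -[X in _ --> X](mulr0 (Num.sqrt (pi * s))^-1).
apply: cvgMr.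
rewrite (_ : (fun x => _) = gauss_fun \o (fun x => x / Num.sqrt s)); last first.
  apply/funext => x /=; rewrite /gauss_fun exprMn exprVn sqr_sqrtr ?(ltW s0)//.
  by rewrite mulNr.
apply: cvg_comp; last exact: cvg_gauss_fun.
apply: gt0_cvgMly; last exact: cvg_id.
by rewrite invr_gt0 sqrtr_gt0.
Qed.

(** The density [g] solves [g' = - (2 * x / s) * g], which gives the first-moment integrand an
    elementary antiderivative. *)
Lemma is_derive_gauss1 (R : realType) (s x : R) : 0 < s ->
  is_derive x 1 (fun x => - (s / 2) * gauss1 R s x) (x * gauss1 R s x).
Proof.
move=> s0; rewrite /gauss1.
apply: is_derive_eq.
rewrite /GRing.scale/=.
by field; rewrite !gt_eqF ?sqrtr_gt0 ?mulr_gt0 ?pi_gt0.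
Qed.

(** The antiderivative of [is_derive_gauss1] vanishes at infinity, so only its value at [a]
    survives; [0 <= a] keeps the integrand nonnegative. *)
Lemma integral_id_gauss1_ge (R : realType) (s a : R) : 0 < s -> 0 <= a ->
  (\int[lebesgue_measure]_(x in `[a, +oo[) (x * gauss1 R s x)%:E =
   (s / 2 * gauss1 R s a)%:E)%E.
Proof.
move=> s0 a0; have dF x := is_derive_gauss1 R s x s0.
rewrite (@ge0_continuous_FTC2y R _ (fun x => - (s / 2) * gauss1 R s x) a 0).
- by rewrite sub0e -EFinN mulNr opprK.
- by move=> x ax; rewrite mulr_ge0 ?gauss1_ge0// (le_trans a0).
- apply: continuous_subspaceT => x; apply: cvgM; first exact: cvg_id.
  exact: continuous_gauss1.
- by rewrite -[X in _ --> X](mulr0 (- (s / 2))); apply: cvgMr; exact: cvg_gauss1_y.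
- by move=> x _; apply: ex_derive; exact: dF.
- apply: cvg_at_right_filter; apply: cvgMr; exact: continuous_gauss1.
- by move=> x _; rewrite derive1E; apply: derive_val.
Qed.

Lemma ge0_integralN (R : realType) (f : R -> \bar R) :
  measurable_fun setT f -> (forall x, (0 <= f x)%E) ->
  (\int[lebesgue_measure]_x f (- x)%R = \int[lebesgue_measure]_x f x)%E.
Proof.
move=> mf f0.
transitivity (\int[lebesgue_measure]_(r in
    (-%R : _ -> measurableTypeR R) @^-1` setT) f (- r)%R)%E.
  by rewrite preimage_setT.
rewrite -ge0_integral_pushforward//=.
by apply: eq_measure_integral => A mA _; exact: lebesgue_measureN.
Qed.

Lemma integral_gauss1_ge0 (R : realType) (s : R) : 0 < s ->
  (\int[lebesgue_measure]_(x in `[0%R, +oo[) (gauss1 R s x)%:E = 2^-1%:E)%E.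
Proof.
move=> s0; have := integral_gauss1 R s s0.
rewrite ge0_symfun_integralT; last 3 first.
- exact: gauss1_ge0.
- exact: continuous_gauss1.
- by move=> x; rewrite /= gauss1N.
rewrite -set_itvcy; move: (integral _ _ _) => I h.
(* Multiplying by [2^-1] instead of cancelling [2] avoids showing first that [I] is finite. *)
have -> : I = (2^-1%:E * (2%:E * I))%E by rewrite muleA -EFinM mulVf// mul1e.
by rewrite h mule1.
Qed.

(** By [gauss1M] the integrand is a constant times an even probability density, half of whose mass
    lies on the half-line. *)
Lemma integral_gauss1M_ge0 (R : realType) (s e : R) : 0 < s -> 0 < e ->
  (\int[lebesgue_measure]_(x in `[0%R, +oo[) (gauss1 R s x * gauss1 R e x)%:E =
   ((Num.sqrt (pi * (s + e)))^-1 / 2)%:E)%E.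
Proof.
move=> s0 e0; have q0 : 0 < s * e / (s + e) by rewrite divr_gt0 ?mulr_gt0 ?addr_gt0.
under eq_integral do rewrite gauss1M// EFinM.
rewrite ge0_integralZl//=; last 2 first.
- apply/measurable_EFinP; apply: measurable_funTS; exact: measurable_gauss1.
- by move=> x _; rewrite lee_fin gauss1_ge0.
by rewrite integral_gauss1_ge0.
Qed.

(** * One-dimensional expectations restricted to a sign, and their symmetries *)

(* P(q (x + y) > 0) for y ~ N(0, e / 2). *)
Definition sgn_prob (R : realType) (q e x : R) : \bar R :=
  (\int[lebesgue_measure]_y (\1_[set u : R | (0 < q * u)%R] (x + y) * gauss1 R e y)%:E)%E.

(* E[u(x); q (x + y) > 0] for independent x ~ N(0, s / 2), y ~ N(0, e / 2). *)
Definition sgn_mean (R : realType) (u : R -> R) (q s e : R) : \bar R :=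
  (\int[lebesgue_measure]_x ((u x)%:E * sgn_prob R q e x * (gauss1 R s x)%:E))%E.

Lemma measurable_sgn_set (R : realType) (q : R) :
  measurable [set u : R | 0 < q * u].
Proof.
have mq : measurable_fun [set: R] (fun u => q * u) by exact: measurable_funM.
rewrite (_ : [set u | _] = (fun u => q * u) @^-1` `]0, +oo[).
  by rewrite -[X in measurable X]setTI; exact: mq.
by apply/seteqP; split => x /=; rewrite in_itv/= andbT.
Qed.

Lemma sgn_prob_ge0 (R : realType) (q e x : R) : (0 <= sgn_prob R q e x)%E.
Proof.
by apply: integral_ge0 => y _; rewrite lee_fin mulr_ge0 ?gauss1_ge0.
Qed.

Lemma measurable_sgn_kernel (R : realType) (q e : R) :
  measurable_fun setT (fun z : R * R =>
    (\1_[set u : R | (0 < q * u)%R] (z.1 + z.2) * gauss1 R e z.2)%:E).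
Proof.
apply/measurable_EFinP/measurable_funM.
  apply: measurableT_comp; last exact: measurable_funD.
  by apply: measurable_indic; exact: measurable_sgn_set.
by apply: measurableT_comp => //; exact: measurable_gauss1.
Qed.

Lemma measurable_sgn_prob (R : realType) (q e : R) :
  measurable_fun setT (sgn_prob R q e).
Proof.
apply: (measurable_fun_fubini_tonelli_F (m2 := lebesgue_measure)
  (fun z : R * R => (\1_[set u : R | (0 < q * u)%R] (z.1 + z.2) *
    gauss1 R e z.2)%:E)).
  exact: measurable_sgn_kernel.
by move=> z; rewrite lee_fin mulr_ge0 ?gauss1_ge0.
Qed.

Lemma measurable_EFin_gauss1 (R : realType) (s : R) :
  measurable_fun setT (fun x => (gauss1 R s x)%:E).
Proof. by apply/measurable_EFinP; exact: measurable_gauss1. Qed.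

Lemma measurable_EFin_shift_gauss1 (R : realType) (q e x : R) :
  measurable_fun setT (fun y =>
    (\1_[set u : R | (0 < q * u)%R] (x + y) * gauss1 R e y)%:E).
Proof.
apply/measurable_EFinP/measurable_funM; last exact: measurable_gauss1.
apply: measurableT_comp; last exact: measurable_funD.
by apply: measurable_indic; exact: measurable_sgn_set.
Qed.

(** The substitution of [- y] for [y] preserves the even noise density, and
    [(- q) * (x + y) = q * (- x + - y)]. *)
Lemma sgn_probN (R : realType) (q e x : R) :
  sgn_prob R (- q) e x = sgn_prob R q e (- x).
Proof.
rewrite /sgn_prob -[RHS]ge0_integralN; last 2 first.
- exact: measurable_EFin_shift_gauss1.
- by move=> y; rewrite lee_fin mulr_ge0 ?gauss1_ge0.
apply: eq_integral => y _; rewrite gauss1N; congr (_ * _)%:E.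
rewrite !indicE; congr (nat_of_bool _)%:R.
by apply/idP/idP; rewrite !inE/= -opprD mulNr mulrN.
Qed.

(** Moves a sign from [q] to the argument of [u]: for constant [u] both signs give the same value,
    and the positive part of the identity turns into the negative part. *)
Lemma sgn_meanN (R : realType) (u : R -> R) (q s e : R) :
  measurable_fun setT u -> (forall x, 0 <= u x) ->
  sgn_mean R u (- q) s e = sgn_mean R (fun x => u (- x)) q s e.
Proof.
move=> mu u0; rewrite /sgn_mean -[LHS]ge0_integralN.
- by apply: eq_integral => x _; rewrite sgn_probN opprK gauss1N.
- apply: emeasurable_funM; last by apply/measurable_EFinP; exact: measurable_gauss1.
  apply: emeasurable_funM; first exact/measurable_EFinP.
  exact: measurable_sgn_prob.
- move=> x; rewrite mule_ge0 ?lee_fin ?gauss1_ge0// mule_ge0 ?lee_fin//.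
  exact: sgn_prob_ge0.
Qed.

Lemma indic_sgn_set (R : realType) (q v : R) :
  \1_[set u : R | 0 < q * u] v = (0 < q * v)%R%:R :> R.
Proof.
by rewrite indicE; congr (nat_of_bool _)%:R; apply/idP/idP; rewrite inE.
Qed.

(** The two events cover everything except [y = - x], a single point of measure zero. *)
Lemma sgn_probD (R : realType) (e x : R) : 0 < e ->
  (sgn_prob R 1 e x + sgn_prob R (-1) e x = 1)%E.
Proof.
move=> e0; rewrite /sgn_prob -ge0_integralD//; last 4 first.
- by move=> y _; rewrite lee_fin mulr_ge0 ?gauss1_ge0.
- exact: measurable_EFin_shift_gauss1.
- by move=> y _; rewrite lee_fin mulr_ge0 ?gauss1_ge0.
- exact: measurable_EFin_shift_gauss1.
(* Both integrals drop the point [- x], at which both indicators vanish. *)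
have D1 (f : R -> \bar R) : measurable_fun setT f ->
    (\int[lebesgue_measure]_y f y =
     \int[lebesgue_measure]_(y in setT `\ (- x)%R) f y)%E.
  move=> mf; rewrite integral_setD1//; first exact: measurableD.
  exact: measurable_funTS.
rewrite -(integral_gauss1 R e e0) D1; last exact: measurable_EFin_gauss1.
rewrite [LHS]D1; last first.
  by apply: emeasurable_funD; exact: measurable_EFin_shift_gauss1.
apply: eq_integral => y; rewrite inE/= => -[_ /eqP yx].
rewrite -EFinD -mulrDl -[in RHS](mul1r (gauss1 R e y)); congr (_ * _)%:E.
rewrite !indic_sgn_set mul1r mulN1r oppr_gt0.
have : x + y != 0 by rewrite addrC addr_eq0.
by case: ltgtP; rewrite ?addr0 ?add0r.
Qed.

Lemma measurable_sgn_mean_integrand (R : realType) (u : R -> R) (q s e : R) :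
  measurable_fun setT u ->
  measurable_fun setT
    (fun x => ((u x)%:E * sgn_prob R q e x * (gauss1 R s x)%:E)%E).
Proof.
move=> mu; apply: emeasurable_funM; last exact: measurable_EFin_gauss1.
apply: emeasurable_funM; first exact/measurable_EFinP.
exact: measurable_sgn_prob.
Qed.

Lemma sgn_mean_integrand_ge0 (R : realType) (u : R -> R) (q s e x : R) :
  0 <= u x -> (0 <= (u x)%:E * sgn_prob R q e x * (gauss1 R s x)%:E)%E.
Proof.
move=> u0; rewrite mule_ge0 ?lee_fin ?gauss1_ge0// mule_ge0 ?lee_fin//.
exact: sgn_prob_ge0.
Qed.

(** By [sgn_probD] the two sign restrictions together impose none; a value for one sign therefore
    yields the value for the other. *)
Lemma sgn_meanD (R : realType) (u : R -> R) (s e : R) : 0 < e ->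
  measurable_fun setT u -> (forall x, 0 <= u x) ->
  (sgn_mean R u 1 s e + sgn_mean R u (-1) s e =
   \int[lebesgue_measure]_x (u x * gauss1 R s x)%:E)%E.
Proof.
move=> e0 mu u0; rewrite /sgn_mean -ge0_integralD//; last 4 first.
- by move=> x _; exact: sgn_mean_integrand_ge0.
- exact: measurable_sgn_mean_integrand.
- by move=> x _; exact: sgn_mean_integrand_ge0.
- exact: measurable_sgn_mean_integrand.
apply: eq_integral => x _.
rewrite -ge0_muleDl ?mule_ge0 ?lee_fin ?sgn_prob_ge0//.
by rewrite -ge0_muleDr ?sgn_prob_ge0// sgn_probD// mule1 EFinM.
Qed.

Lemma sgn_mean1 (R : realType) (q s e : R) : q \in [:: 1; -1] ->
  0 < s -> 0 < e -> sgn_mean R (fun=> 1) q s e = 2^-1%:E.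
Proof.
move=> q1 s0 e0.
have /= h := sgn_meanN R (fun=> 1) 1 s e (measurable_cst _) (fun=> ler01).
have := sgn_meanD R (fun=> 1) s e e0 (measurable_cst _) (fun=> ler01).
under eq_integral do rewrite mul1r.
rewrite (integral_gauss1 R s s0); move: (sgn_mean R _) h => m h; rewrite h => h1.
have {}h1 : m 1 s e = 2^-1%:E.
  (* An infinite value is excluded, because its double would not be [1]. *)
  by case: (m 1 s e) h1 => // r; rewrite -EFinD => -[r1]; congr EFin; lra.
by move: q1; rewrite !inE => /orP[] /eqP ->; rewrite ?h h1.
Qed.

(** * First moments of the positive and negative parts under a sign restriction *)

(** The positive part forces [x > 0] and the indicator forces [x > - y], so the integral runs over
    the half-line starting at the larger of the two bounds. Including that endpoint changes
    nothing. *)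
Lemma integral_posid_gauss1_gt (R : realType) (s y : R) : 0 < s ->
  (\int[lebesgue_measure]_x (Num.max x 0 *
     \1_[set u : R | (0 < 1 * u)%R] (x + y) * gauss1 R s x)%:E =
   (s / 2 * gauss1 R s (Num.max (- y) 0))%:E)%E.
Proof.
move=> s0; rewrite -integral_id_gauss1_ge//; last by rewrite le_max lexx orbT.
rewrite -integral_itv_obnd_cbnd; last first.
  apply: measurable_funTS; apply/measurable_EFinP/measurable_funM => //.
  exact: measurable_gauss1.
rewrite [RHS]integral_mkcond; apply: eq_integral => x _.
rewrite patchE mem_setE in_itv/= andbT indic_sgn_set mul1r gt_max.
case: (ltP 0 x) => x0; last by rewrite andbF !mul0r.
rewrite -(subr_gt0 (- y)) opprK andbT.
by case: ifP => _; rewrite ?mulr1 ?mulr0 ?mul0r.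
Qed.

(** After reflecting [y], the line is split at [0]. On [y >= 0] the integrand is a product of two
    densities, treated by [integral_gauss1M_ge0]; on [y < 0] the first factor is frozen at
    [gauss1 R s 0] and half of the mass of the second remains. *)
Lemma integral_gauss1_max (R : realType) (s e : R) : 0 < s -> 0 < e ->
  (\int[lebesgue_measure]_y (gauss1 R s (Num.max (- y) 0) * gauss1 R e y)%:E =
   (((Num.sqrt (pi * (s + e)))^-1 + gauss1 R s 0) / 2)%:E)%E.
Proof.
move=> s0 e0.
have mf : measurable_fun setT
    (fun y : R => (gauss1 R s (Num.max y 0) * gauss1 R e y)%:E).
  apply/measurable_EFinP/measurable_funM; last exact: measurable_gauss1.
  apply: measurableT_comp; first exact: measurable_gauss1.
  exact: measurable_maxr.
have f0 y : (0 <= (gauss1 R s (Num.max y 0) * gauss1 R e y)%:E)%E.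
  by rewrite lee_fin mulr_ge0 ?gauss1_ge0.
transitivity (\int[lebesgue_measure]_y
    (gauss1 R s (Num.max y 0) * gauss1 R e y)%:E)%E.
  rewrite -[RHS](ge0_integralN R _ mf f0).
  by apply: eq_integral => y _; rewrite gauss1N.
rewrite -(setUv `[0, +oo[%classic) ge0_integral_setU//=; last 3 first.
- exact: measurableC.
- by rewrite setUv.
- exact/disj_setPCl.
(* The null point [0] is added so that reflecting the negative half-line gives [[0, +oo[]. *)
rewrite setCitvr integral_itv_bndo_bndc; last exact: measurable_funTS.
rewrite mulrDl EFinD; congr (_ + _)%E.
  rewrite -(integral_gauss1M_ge0 R s e s0 e0); apply: eq_integral => y.
  by rewrite inE/= in_itv/= andbT => /max_idPl ->.
transitivity (\int[lebesgue_measure]_(y in `[0%R, +oo[)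
    (gauss1 R s (Num.max (- y) 0) * gauss1 R e (- y))%:E)%E.
  rewrite [RHS]ge0_integration_by_substitution0.
  - by apply: eq_integral => y _; rewrite opprK.
  - apply: (measurableT_comp mf); exact: oppr_measurable.
  - by move=> y; exact: f0.
rewrite EFinM -(integral_gauss1_ge0 R e e0) -ge0_integralZl; last 4 first.
- exact: measurable_itv.
- by apply: measurable_funTS; exact: measurable_EFin_gauss1.
- by move=> x _; rewrite lee_fin gauss1_ge0.
- by rewrite lee_fin gauss1_ge0.
apply: eq_integral => y; rewrite inE/= in_itv/= andbT => y0.
by rewrite gauss1N (max_idPr _) ?oppr_le0// EFinM.
Qed.

Lemma integral_posid_gauss1 (R : realType) (s : R) : 0 < s ->
  (\int[lebesgue_measure]_x (Num.max x 0 * gauss1 R s x)%:E =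
   (s / 2 * gauss1 R s 0)%:E)%E.
Proof.
move=> s0; rewrite -(integral_id_gauss1_ge R s 0 s0 (lexx _)).
rewrite [RHS]integral_mkcond; apply: eq_integral => x _.
rewrite patchE mem_setE in_itv/= andbT.
by case: ifPn => [/max_idPl ->//|]; rewrite -ltNge => /ltW/max_idPr ->; rewrite mul0r.
Qed.

(** Tonelli exchanges the order: integrating over [y] first would produce an error function, while
    the integral over [x] is elementary and leaves the one of [integral_gauss1_max]. *)
Lemma sgn_mean_posid1 (R : realType) (s e : R) : 0 < s -> 0 < e ->
  sgn_mean R (Num.max^~ 0) 1 s e =
  (s / 2 * (((Num.sqrt (pi * (s + e)))^-1 + gauss1 R s 0) / 2))%:E.
Proof.
move=> s0 e0; rewrite EFinM -(integral_gauss1_max R s e s0 e0).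
pose F (x y : R) : R := Num.max x 0 *
  \1_[set u : R | (0 < 1 * u)%R] (x + y) * gauss1 R s x * gauss1 R e y.
have mF : measurable_fun setT (fun z : R * R => (F z.1 z.2)%:E).
  apply/measurable_EFinP; rewrite /F.
  apply: measurable_funM; [apply: measurable_funM; [apply: measurable_funM|]|].
  - exact: measurable_maxr.
  - apply: measurableT_comp; last exact: measurable_funD.
    by apply: measurable_indic; exact: measurable_sgn_set.
  - by apply: measurableT_comp; first exact: measurable_gauss1.
  - by apply: measurableT_comp; first exact: measurable_gauss1.
have F0 z : (0 <= (F z.1 z.2)%:E)%E.
  by rewrite lee_fin !mulr_ge0 ?gauss1_ge0// le_max lexx orbT.
transitivity (\int[lebesgue_measure]_x \int[lebesgue_measure]_y (F x y)%:E)%E.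
  apply: eq_integral => x _; rewrite muleAC -EFinM /sgn_prob -ge0_integralZl.
  - by apply: eq_integral => y _; rewrite -EFinM /F; congr EFin; ring.
  - exact: measurableT.
  - exact: measurable_EFin_shift_gauss1.
  - by move=> y _; rewrite lee_fin mulr_ge0 ?gauss1_ge0.
  - by rewrite lee_fin mulr_ge0 ?gauss1_ge0// le_max lexx orbT.
apply: (etrans (fubini_tonelli (m1 := lebesgue_measure)
  (m2 := lebesgue_measure) _ mF F0)); rewrite -ge0_integralZl/=.
- apply: eq_integral => y _.
  transitivity (\int[lebesgue_measure]_x ((gauss1 R e y)%:E * (Num.max x 0 *
     \1_[set u : R | (0 < 1 * u)%R] (x + y) * gauss1 R s x)%:E))%E.
    by apply: eq_integral => x _; rewrite -EFinM /F; congr EFin; ring.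
  rewrite ge0_integralZl.
  + rewrite integral_posid_gauss1_gt// -!EFinM; congr EFin; ring.
  + exact: measurableT.
  + apply/measurable_EFinP; apply: measurable_funM; [apply: measurable_funM|].
    * exact: measurable_maxr.
    * apply: measurableT_comp; last exact: measurable_funD.
      by apply: measurable_indic; exact: measurable_sgn_set.
    * exact: measurable_gauss1.
  + by move=> x _; rewrite lee_fin !mulr_ge0 ?gauss1_ge0// le_max lexx orbT.
  + by rewrite lee_fin gauss1_ge0.
- exact: measurableT.
- apply/measurable_EFinP/measurable_funM; last exact: measurable_gauss1.
  apply: measurableT_comp; first exact: measurable_gauss1.
  exact: measurable_maxr.
- by move=> y _; rewrite lee_fin mulr_ge0 ?gauss1_ge0.
- by rewrite lee_fin divr_ge0// ltW.
Qed.

(** By [sgn_meanD] this is the unrestricted moment [s / 2 * gauss1 R s 0] minus the value for the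
    sign [1]. *)
Lemma sgn_mean_posidN1 (R : realType) (s e : R) : 0 < s -> 0 < e ->
  sgn_mean R (Num.max^~ 0) (-1) s e =
  (s / 2 * ((gauss1 R s 0 - (Num.sqrt (pi * (s + e)))^-1) / 2))%:E.
Proof.
move=> s0 e0; have : (sgn_mean R (Num.max^~ 0%R) 1 s e +
    sgn_mean R (Num.max^~ 0%R) (-1) s e =
    \int[lebesgue_measure]_x (Num.max x 0 * gauss1 R s x)%:E)%E.
  apply: sgn_meanD => //; first exact: measurable_maxr.
  by move=> x; rewrite le_max lexx orbT.
rewrite (sgn_mean_posid1 R s e s0 e0) (integral_posid_gauss1 R s s0).
case: (sgn_mean _ _ _ _ _) => // r; rewrite -EFinD => -[rE]; congr EFin.
apply: (addrI (s / 2 * (((Num.sqrt (pi * (s + e)))^-1 + gauss1 R s 0) / 2))).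
rewrite rE; move: (Num.sqrt _)^-1 (gauss1 _ _ _) => a b; by field.
Qed.

(** * Planar moments as sums over the mixture components *)

Lemma measurable_cgauss_pdf (R : realType) (s : R) : 0 < s ->
  measurable_fun setT (fun z => cgauss_pdf s z).
Proof.
move=> s0; rewrite (_ : (fun z => _) =
    (fun z : R * R => gauss1 R s z.1 * gauss1 R s z.2)); last first.
  by apply/funext => z; rewrite cgauss_pdfE.
by apply: measurable_funM; apply: measurableT_comp => //;
  exact: measurable_gauss1.
Qed.

Lemma cgauss_pdf_ge0 (R : realType) (s : R) (z : R * R) :
  0 < s -> 0 <= cgauss_pdf s z.
Proof. by move=> s0; rewrite cgauss_pdfE// mulr_ge0 ?gauss1_ge0. Qed.

Definition sgn_ind (R : realType) (q x : R) : R := \1_[set u : R | 0 < q * u] x.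

Lemma sgn_ind_ge0 (R : realType) (q x : R) : 0 <= sgn_ind R q x.
Proof. by rewrite /sgn_ind indic_sgn_set. Qed.

Lemma measurable_sgn_ind (R : realType) (q : R) : measurable_fun setT (sgn_ind R q).
Proof. by apply: measurable_indic; exact: measurable_sgn_set. Qed.

(** Integrates out the noise for a fixed value [z] of [h]; the coordinates of the noise are
    independent, so the two sign events factor. *)
Lemma integral_leb2_sgn_prob (R : realType) (q1 q2 e a : R) (z : R * R) :
  0 < e -> 0 <= a ->
  (\int[leb2 R]_w ((a * (sgn_ind R q1 (z.1 + w.1) * sgn_ind R q2 (z.2 + w.2)))%:E
     * (cgauss_pdf e w)%:E) =
   a%:E * (sgn_prob R q1 e z.1 * sgn_prob R q2 e z.2))%E.
Proof.
move=> e0 a0.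
have t0 (q x y : R) : (0 <= (sgn_ind R q (x + y) * gauss1 R e y)%:E)%E.
  by rewrite lee_fin mulr_ge0 ?gauss1_ge0 ?sgn_ind_ge0.
rewrite /sgn_prob -ge0_integral_tensor; last 4 first.
- exact: measurable_EFin_shift_gauss1.
- exact: measurable_EFin_shift_gauss1.
- by move=> y; exact: t0.
- by move=> y; exact: t0.
rewrite -ge0_integralZl//.
- apply: eq_integral => w _; rewrite cgauss_pdfE// -!EFinM; congr EFin.
  rewrite /sgn_ind; ring.
- apply: emeasurable_funM.
  + apply: (measurableT_comp (measurable_EFin_shift_gauss1 R q1 e z.1)).
    exact: measurable_fst.
  + apply: (measurableT_comp (measurable_EFin_shift_gauss1 R q2 e z.2)).
    exact: measurable_snd.
- by move=> w _; apply: mule_ge0; exact: t0.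
Qed.

(** The mixture density is in general not a product over the coordinates, but each component is;
    hence a weighted sum of products. *)
Lemma integral_mix_sgn_mean (R : realType) (K : nat) (p s2 : 'I_K -> R)
    (e q1 q2 : R) (u v : R -> R) :
  (forall k, 0 < p k) -> (forall k, 0 < s2 k) -> 0 < e ->
  measurable_fun setT u -> measurable_fun setT v ->
  (forall x, 0 <= u x) -> (forall x, 0 <= v x) ->
  (\int[leb2 R]_z ((u z.1 * v z.2)%:E *
       (sgn_prob R q1 e z.1 * sgn_prob R q2 e z.2) *
       (cgauss_mix_pdf p s2 z)%:E) =
   \sum_(k < K) (p k)%:E *
     (sgn_mean R u q1 (s2 k) e * sgn_mean R v q2 (s2 k) e))%E.
Proof.
move=> p0 s0 e0 mu mv u0 v0.
(* The integrand of component [k], regrouped as a function of [z.1] times a function of [z.2]. *)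
pose G (k : 'I_K) (z : R * R) : \bar R :=
  (((u z.1)%:E * sgn_prob R q1 e z.1 * (gauss1 R (s2 k) z.1)%:E) *
   ((v z.2)%:E * sgn_prob R q2 e z.2 * (gauss1 R (s2 k) z.2)%:E))%E.
have mG k : measurable_fun setT (G k).
  apply: emeasurable_funM.
  - apply: (measurableT_comp
      (measurable_sgn_mean_integrand R u q1 (s2 k) e mu)).
    exact: measurable_fst.
  - apply: (measurableT_comp
      (measurable_sgn_mean_integrand R v q2 (s2 k) e mv)).
    exact: measurable_snd.
have G0 k z : (0 <= G k z)%E.
  by rewrite mule_ge0//; exact: sgn_mean_integrand_ge0.
transitivity (\int[leb2 R]_z (\sum_(k < K) (p k)%:E * G k z))%E.
  apply: eq_integral => z _; rewrite /cgauss_mix_pdf -sumEFin ge0_sume_distrr.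
    apply: eq_bigr => k _; rewrite cgauss_pdfE// /G (EFinM (u _)) (EFinM (p k)).
    rewrite (EFinM (gauss1 _ _ _)) [LHS]muleCA.
    rewrite (muleACA (u z.1)%:E).
    by congr (_ * _)%E; exact: muleACA.
  by move=> k _; rewrite lee_fin mulr_ge0 ?cgauss_pdf_ge0// ltW.
rewrite ge0_integral_sum//.
- apply: eq_bigr => k _; rewrite ge0_integralZl ?lee_fin ?ltW//; last exact: mG.
  congr (_ * _)%E; rewrite /sgn_mean -ge0_integral_tensor.
  + by [].
  + exact: measurable_sgn_mean_integrand.
  + exact: measurable_sgn_mean_integrand.
  + by move=> x; exact: sgn_mean_integrand_ge0.
  + by move=> x; exact: sgn_mean_integrand_ge0.
- by move=> k; apply: emeasurable_funM => //; exact: mG.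
- by move=> k z _; rewrite mule_ge0// lee_fin ltW.
Qed.

(** One formula for every moment needed: [u] and [v] range over the constant [1] and the positive
    and negative parts of the identity, so that Tonelli always applies. *)
Lemma expectation_sgn_mean (R : realType) (d : measure_display)
    (T : measurableType d) (P : probability T R) (K : nat) (p s2 : 'I_K -> R)
    (e : R) (h n : T -> R * R) (q1 q2 : R) (u v : R -> R) :
  (forall k, 0 < p k) -> (forall k, 0 < s2 k) -> 0 < e ->
  has_density P h (cgauss_mix_pdf p s2) ->
  has_density P n (cgauss_pdf e) -> indep2 P h n ->
  measurable_fun setT u -> measurable_fun setT v ->
  (forall x, 0 <= u x) -> (forall x, 0 <= v x) ->
  (\int[P]_t (u (h t).1 * v (h t).2 *
     (sgn_ind R q1 ((h t).1 + (n t).1) * sgn_ind R q2 ((h t).2 + (n t).2)))%:E =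
   \sum_(k < K) (p k)%:E *
     (sgn_mean R u q1 (s2 k) e * sgn_mean R v q2 (s2 k) e))%E.
Proof.
move=> p0 s0 e0 [mh hE] [mn nE] hn mu mv u0 v0.
rewrite -(integral_mix_sgn_mean R K p s2 e q1 q2 u v p0 s0 e0 mu mv u0 v0).
pose F (z : (R * R) * (R * R)) : \bar R := (u z.1.1 * v z.1.2 *
  (sgn_ind R q1 (z.1.1 + z.2.1) * sgn_ind R q2 (z.1.2 + z.2.2)))%:E.
have mF : measurable_fun setT F.
  apply/measurable_EFinP; apply: measurable_funM; apply: measurable_funM.
  - apply: (measurableT_comp mu).
    by apply: measurableT_comp; [exact: measurable_fst|exact: measurable_fst].
  - apply: (measurableT_comp mv).
    by apply: measurableT_comp; [exact: measurable_snd|exact: measurable_fst].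
  - apply: (measurableT_comp (measurable_sgn_ind R q1)).
    by apply: measurable_funD; apply: measurableT_comp.
  - apply: (measurableT_comp (measurable_sgn_ind R q2)).
    by apply: measurable_funD; apply: measurableT_comp.
have F0 z : (0 <= F z)%E by rewrite lee_fin !mulr_ge0 ?sgn_ind_ge0.
have mf : measurable_fun setT (cgauss_mix_pdf p s2).
  apply: measurable_sum => k; apply: measurable_funM => //.
  exact: measurable_cgauss_pdf.
have f0 z : 0 <= cgauss_mix_pdf p s2 z.
  by apply: sumr_ge0 => k _; rewrite mulr_ge0 ?cgauss_pdf_ge0// ltW.
(* The measure of [leb2 R], on the carrier at which [pair_pushforwardE] is instantiated. *)
pose m2 : {measure set (measurableTypeR R * measurableTypeR R)%type -> \bar R} :=
  (@lebesgue_measure R \x @lebesgue_measure R)%E.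
rewrite [LHS](pair_pushforwardE _ _ T (measurableTypeR R * measurableTypeR R)%type
  R P m2 h n
  (cgauss_mix_pdf p s2) (cgauss_pdf e) F mh mn mf (measurable_cgauss_pdf R e e0)
  f0 (fun z => cgauss_pdf_ge0 R e z e0) hE nE hn mF F0).
apply: eq_integral => z _; congr (_ * _)%E.
by rewrite -integral_leb2_sgn_prob// mulr_ge0.
Qed.

(** * From moments of positive and negative parts to the conditional mean *)

Lemma sgn_mean_posid (R : realType) (q s e : R) : q \in [:: 1; -1] ->
  0 < s -> 0 < e ->
  sgn_mean R (Num.max^~ 0) q s e =
  (s / 2 * ((gauss1 R s 0 + q * (Num.sqrt (pi * (s + e)))^-1) / 2))%:E.
Proof.
move=> q1 s0 e0; move: q1; rewrite !inE => /orP[] /eqP ->.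
  by rewrite (sgn_mean_posid1 R s e s0 e0) mul1r addrC.
by rewrite (sgn_mean_posidN1 R s e s0 e0) mulN1r.
Qed.

(** Reflection trades the negative part for the positive part under the sign [- q]. Compared with
    [sgn_mean_posid] only the square root term changes sign. *)
Lemma sgn_mean_negid (R : realType) (q s e : R) : q \in [:: 1; -1] ->
  0 < s -> 0 < e ->
  sgn_mean R (fun x => Num.max (- x) 0) q s e =
  (s / 2 * ((gauss1 R s 0 - q * (Num.sqrt (pi * (s + e)))^-1) / 2))%:E.
Proof.
move=> q1 s0 e0; rewrite -(sgn_meanN R (Num.max^~ 0)).
- rewrite sgn_mean_posid ?mulNr//.
  by move: q1; rewrite !inE eqr_opp eqr_oppLR orbC.
- exact: measurable_maxr.
- by move=> x; rewrite le_max lexx orbT.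
Qed.

(** The integral of a signed function is the difference of those of its positive and negative parts;
    real values [a] and [b] rule out an indeterminate difference before [fine] is applied. *)
Lemma cond_meanE (d : measure_display) (T : measurableType d) (R : realType)
    (P : probability T R) (X : T -> R) (E : set T) (a b c : R) :
  measurable E ->
  (\int[P]_t (Num.max (X t) 0 * \1_E t)%:E = a%:E)%E ->
  (\int[P]_t (Num.max (- X t) 0 * \1_E t)%:E = b%:E)%E ->
  (\int[P]_t (\1_E t)%:E = c%:E)%E ->
  cond_mean P X E = (a - b) / c.
Proof.
move=> mE aE bE cE; rewrite /cond_mean.
have -> : P E = c%:E by rewrite -cE integral_indic// setIT.
rewrite integralE (_ : (\int[P]_(t in E) _)%E = a%:E); last first.
  rewrite -aE integral_mkcond epatch_indic.
  by apply: eq_integral => t _; rewrite /= funeposE EFinM EFin_max.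
rewrite (_ : (\int[P]_(t in E) _)%E = b%:E)//.
rewrite -bE integral_mkcond epatch_indic.
by apply: eq_integral => t _; rewrite /= funenegE EFinM EFin_max.
Qed.

(** Since [sg 0 = 0] differs from both admissible [q], the boundary case [x = 0] fails on either
    side. *)
Lemma sgr_sqrt2P (R : realType) (q x : R) : q \in [:: 1; -1] ->
  Num.sg x / Num.sqrt 2 = q / Num.sqrt 2 <-> 0 < q * x.
Proof.
have r2 : (Num.sqrt 2 : R)^-1 != 0 by rewrite invr_eq0 gt_eqF// sqrtr_gt0.
have -> : (Num.sg x / Num.sqrt 2 = q / Num.sqrt 2) <-> Num.sg x = q.
  by split=> [/(mulIf r2)|->].
rewrite !inE => /orP[] /eqP ->; split => [/eqP|].
- by rewrite sgr_cp0 mul1r.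
- by rewrite mul1r => /gtr0_sg.
- by rewrite sgr_cp0 mulN1r oppr_gt0.
- by rewrite mulN1r oppr_gt0 => /ltr0_sg.
Qed.

(** The factor [2^-1] comes from the other coordinate and [4^-1] is the probability of a quadrant.
    The [gauss1] terms cancel, leaving [p k * s2 k * q / sqrt (pi * (s2 k + e))] in each summand;
    the [sqrt 2] of the constant absorbs the one dividing [q]. *)
Lemma cond_mean_slopeE (R : realType) (K : nat) (p s2 : 'I_K -> R) (e q : R) :
  (forall k, 0 < s2 k) -> 0 < e ->
  (\sum_(k < K) p k * (s2 k / 2 * ((gauss1 R (s2 k) 0 +
       q * (Num.sqrt (pi * (s2 k + e)))^-1) / 2) * 2^-1) -
   \sum_(k < K) p k * (s2 k / 2 * ((gauss1 R (s2 k) 0 -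
       q * (Num.sqrt (pi * (s2 k + e)))^-1) / 2) * 2^-1)) / 4^-1 =
  Num.sqrt (2 / pi) *
    (\sum_(k < K) p k * s2 k / Num.sqrt (s2 k + e)) * (q / Num.sqrt 2).
Proof.
move=> s0 e0; rewrite -sumrB mulr_suml mulr_sumr mulr_suml.
apply: eq_bigr => k _; have se0 : 0 < s2 k + e by rewrite addr_gt0.
rewrite (sqrtrM (s2 k + e) (pi_ge0 R)) (sqrtrM pi^-1 (ler0n R 2)) sqrtrV ?pi_ge0//.
move: (gauss1 _ _ _) => g.
have /lt0r_neq0 : 0 < Num.sqrt (s2 k + e) by rewrite sqrtr_gt0.
have /lt0r_neq0 : 0 < Num.sqrt (pi : R) by rewrite sqrtr_gt0 pi_gt0.
have /lt0r_neq0 : 0 < Num.sqrt (2 : R) by rewrite sqrtr_gt0.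
by move=> aN bN cN; field; rewrite aN bN cN.
Qed.

(* h, n : T -> C represented as R * R = (Re, Im).  r = Q(h + n).
   For every value q = (s1 + j s2)/sqrt 2 (s1, s2 in {1,-1}) of r,
   E[h | r = q] = c q, stated for real and imaginary parts. *)
Theorem theorem2 (R : realType) (d : measure_display) (T : measurableType d)
  (P : probability T R) (K : nat) (p s2 : 'I_K -> R) (eta2 : R)
  (h n : T -> R * R) :
  (forall k, 0 < p k) -> \sum_(k < K) p k = 1 ->
  (forall k, 0 < s2 k) -> 0 < eta2 ->
  has_density P h (cgauss_mix_pdf p s2) ->
  has_density P n (cgauss_pdf eta2) ->
  indep2 P h n ->
  let r := fun t => ((h t).1 + (n t).1, (h t).2 + (n t).2) in
  let c := Num.sqrt (2 / pi) *
           \sum_(k < K) p k * s2 k / Num.sqrt (s2 k + eta2) in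
  forall q1 q2 : R, q1 \in [:: 1; -1] -> q2 \in [:: 1; -1] ->
  let E := [set t | Qre (r t) = q1 / Num.sqrt 2 /\ Qim (r t) = q2 / Num.sqrt 2] in
  cond_mean P (fun t => (h t).1) E = c * (q1 / Num.sqrt 2) /\
  cond_mean P (fun t => (h t).2) E = c * (q2 / Num.sqrt 2).

Proof.
move=> p0 p1 s0 e0 hd nd hn r c q1 q2 q1P q2P E.
have [mh _] := hd; have [mn _] := nd.
have mr1 : measurable_fun setT (fun t => (r t).1).
  by apply: measurable_funD; apply: measurableT_comp => //; exact: measurable_fst.
have mr2 : measurable_fun setT (fun t => (r t).2).
  by apply: measurable_funD; apply: measurableT_comp => //; exact: measurable_snd.
(* The event is an open quadrant for [h + n], so its indicator factors over the coordinates. *)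
have EE : E = (fun t => (r t).1) @^-1` [set u | 0 < q1 * u] `&`
              (fun t => (r t).2) @^-1` [set u | 0 < q2 * u].
  by apply/seteqP; split => t [/sgr_sqrt2P h1 /sgr_sqrt2P h2]; split;
    [exact: h1|exact: h2|exact: h1|exact: h2].
have mE : measurable E.
  rewrite EE -[X in measurable (X `&` _)]setTI -[X in measurable (_ `&` X)]setTI.
  by apply: measurableI; [exact: mr1 (measurable_sgn_set R q1)|
    exact: mr2 (measurable_sgn_set R q2)].
have indE t : \1_E t = sgn_ind R q1 (r t).1 * sgn_ind R q2 (r t).2.
  by rewrite EE indicI.
have moment u v mu mv u0 v0 := expectation_sgn_mean R d T P K p s2 eta2 h n q1 q2
  u v p0 s0 e0 hd nd hn mu mv u0 v0.
have m1 : measurable_fun setT (fun _ : R => 1 : R) by exact: measurable_cst.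
have mpos : measurable_fun setT (fun x : R => Num.max x 0) by exact: measurable_maxr.
have mneg : measurable_fun setT (fun x : R => Num.max (- x) 0).
  by apply: measurable_maxr => //; exact: oppr_measurable.
have pos0 (x : R) : 0 <= Num.max x 0 by rewrite le_max lexx orbT.
have neg0 (x : R) : 0 <= Num.max (- x) 0 by exact: pos0.
(* Each component gives the quadrant probability [1/2 * 1/2], and the weights sum to [1]. *)
have PE : (\int[P]_t (\1_E t)%:E = 4^-1%:E)%E.
  transitivity (\sum_(k < K) (p k)%:E * (sgn_mean R (fun=> 1%R) q1 (s2 k) eta2 *
      sgn_mean R (fun=> 1%R) q2 (s2 k) eta2))%E.
    rewrite -(moment _ _ m1 m1 (fun=> ler01) (fun=> ler01)).
    by apply: eq_integral => t _; rewrite indE/= !mul1r.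
  under eq_bigr => k _ do rewrite (sgn_mean1 R q1 (s2 k) eta2 q1P (s0 k) e0)
    (sgn_mean1 R q2 (s2 k) eta2 q2P (s0 k) e0) -!EFinM.
  by rewrite sumEFin -mulr_suml p1; congr EFin; field.
(* Four moments remain: positive and negative part, first of the real and then of the imaginary
   coordinate. *)
split; rewrite -cond_mean_slopeE//; apply: cond_meanE => //.
- transitivity (\sum_(k < K) (p k)%:E *
    (sgn_mean R (fun x : R => Num.max x 0%R) q1 (s2 k) eta2 *
     sgn_mean R (fun=> 1%R) q2 (s2 k) eta2))%E.
    rewrite -(moment _ _ mpos m1 pos0 (fun=> ler01)).
    by apply: eq_integral => t _; rewrite indE/= ?mul1r ?mulr1.
  rewrite -sumEFin; apply: eq_bigr => k _.
  by rewrite (sgn_mean_posid R q1 (s2 k) eta2 q1P (s0 k) e0)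
    (sgn_mean1 R q2 (s2 k) eta2 q2P (s0 k) e0)
    -!EFinM.
- transitivity (\sum_(k < K) (p k)%:E *
    (sgn_mean R (fun x : R => Num.max (- x)%R 0%R) q1 (s2 k) eta2 *
     sgn_mean R (fun=> 1%R) q2 (s2 k) eta2))%E.
    rewrite -(moment _ _ mneg m1 neg0 (fun=> ler01)).
    by apply: eq_integral => t _; rewrite indE/= ?mul1r ?mulr1.
  rewrite -sumEFin; apply: eq_bigr => k _.
  by rewrite (sgn_mean_negid R q1 (s2 k) eta2 q1P (s0 k) e0)
    (sgn_mean1 R q2 (s2 k) eta2 q2P (s0 k) e0)
    -!EFinM.
- transitivity (\sum_(k < K) (p k)%:E *
    (sgn_mean R (fun=> 1%R) q1 (s2 k) eta2 *
     sgn_mean R (fun x : R => Num.max x 0%R) q2 (s2 k) eta2))%E.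
    rewrite -(moment _ _ m1 mpos (fun=> ler01) pos0).
    by apply: eq_integral => t _; rewrite indE/= ?mul1r ?mulr1.
  rewrite -sumEFin; apply: eq_bigr => k _.
  by rewrite (sgn_mean_posid R q2 (s2 k) eta2 q2P (s0 k) e0)
    (sgn_mean1 R q1 (s2 k) eta2 q1P (s0 k) e0)
    -!EFinM (mulrC 2^-1).
- transitivity (\sum_(k < K) (p k)%:E *
    (sgn_mean R (fun=> 1%R) q1 (s2 k) eta2 *
     sgn_mean R (fun x : R => Num.max (- x)%R 0%R) q2 (s2 k) eta2))%E.
    rewrite -(moment _ _ m1 mneg (fun=> ler01) neg0).
    by apply: eq_integral => t _; rewrite indE/= ?mul1r ?mulr1.
  rewrite -sumEFin; apply: eq_bigr => k _.
  by rewrite (sgn_mean_negid R q2 (s2 k) eta2 q2P (s0 k) e0)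
    (sgn_mean1 R q1 (s2 k) eta2 q1P (s0 k) e0)
    -!EFinM (mulrC 2^-1).
Qed.
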